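(* Let $\mathcal{A}=\{H_1,\dots,H_m\}$ be a central hyperplane arrangement in $\mathbb{R}^n$ with $m=|\mathcal{A}|$ hyperplanes, and let $w$ be a separating probability measure on its faces. Assume that a group $G$ acts on $\mathbb{R}^n$ preserving the hyperplane arrangement $\mathcal{A}$ and acting transitively on the set of chambers, and that the weights $w$ are $G$-invariant. Assume further that there are $b$ and $d$ bounded away from $1$ such that for every $i\neq j$, $$b=\sum_{F\nsubseteq H_i}w(F)\quad\text{and}\quad \sum_{F\nsubseteq H_i\cup H_j}w(F)=d,$$ with $b\le\frac{1+d}{2}$ and $0<d\le b^2$. Then the random walk on the chambers of $\mathcal{A}$ driven by $w$ exhibits cutoff with respect to the separation distance at time $\log_{\frac{1}{1-b}}m$ with window $\frac1b$.
   Context: A central hyperplane arrangement $\mathcal{A}=\{H_1,\dots,H_m\}$ is a finite collection of hyperplanes of $\mathbb{R}^n$ passing through the origin. For each $i$, let $H_i^+,H_i^-$ be the two open half-spaces determined by $H_i$ and $H_i^0=H_i$. A face is a nonempty set of the form $F=\bigcap_{i=1}^m H_i^{\sigma_i(F)}$ with $\sigma_i(F)\in\{+,-,0\}$. A chamber is a face with $\sigma_i(F)\neq 0$ for all $i$. $\mathcal{F}$ is the set of faces and $\mathcal{C}\subseteq\mathcal{F}$ the set of chambers. The product $FF'$ of two faces is the face with $\sigma_i(FF')=\sigma_i(F)$ if $\sigma_i(F)\ne 0$ and $\sigma_i(FF')=\sigma_i(F')$ otherwise; it is associative, and $FC\in\mathcal{C}$ for $C\in\mathcal{C}$. A probability measure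 $w$ on $\mathcal{F}$ is separating if for every $H\in\mathcal{A}$ there is a face $F\nsubseteq H$ with $w(F)>0$. The weights are $G$-invariant if $w(gF)=w(F)$ for all $g\in G$, $F\in\mathcal{F}$. The walk: at each step a face is picked independently according to $w$; if $F^t$ is the face picked at time $t$, the walk started at $x_0\in\mathcal{C}$ is at time $t$ at $C^t_{x_0}=F^tF^{t-1}\cdots F^1x_0$. As $w$ is separating, this Markov chain has a unique stationary distribution $\pi$ on $\mathcal{C}$. Separation distance: $s(t)=\max_{x_0\in\mathcal{C}}\left(1-\min_{x\in\mathcal{C}}\frac{\mathbb{P}(C^t_{x_0}=x)}{\pi(x)}\right)$. Cutoff is a property of a sequence: $\mathcal{A}=\mathcal{A}_n$ is understood as a sequence of arrangements indexed by the dimension $n$ of $\mathbb{R}^n$ (so $w$, $G$, $m$, $b$, $d$ may depend on $n$). The sequence of walks on the chambers of $\mathcal{A}_n$ exhibits cutoff with respect to the separation distance at $t_n$ with window $r_n=o(t_n)$ if and only if $$\lim_{c\to\infty}\lim_{n\to\infty}s(t_n-c\,r_n)=1\quad\text{and}\quad \lim_{c\to\infty}\lim_{n\to\infty}s(t_n+c\,r_n)=0.$$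
   Formalization: The inner limits over n in the definition of cutoff, which need not exist because times are rounded to integers, are read as liminf (before t_n) and limsup (after t_n); the window condition r_n = o(t_n) is claimed when m tends to infinity, without which it fails. *)

(* Defs.v *)
From HB Require Import structures.
From mathcomp Require Import all_boot all_order all_algebra.
From mathcomp Require Import all_classical all_reals all_analysis.

Set Implicit Arguments.
Unset Strict Implicit.
Unset Printing Implicit Defensive.

Import Order.TTheory GRing.Theory Num.Theory.
Import numFieldNormedType.Exports.

Local Open Scope classical_set_scope.
Local Open Scope ring_scope.

Definition dot (R : realType) (n : nat) (a x : 'cV[R]_n) : R :=
  (a^T *m x) 0 0.

(* The hyperplanes are the kernels of the forms [dot (normal i)]; the choice of
   a normal vector only fixes which open half-space is called positive. *)
Record arrangement (R : realType) (n : nat) := Arrangement {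
  nhyp : nat;
  normal : 'I_nhyp -> 'cV[R]_n;
  normal_neq0 : forall i, normal i != 0;
  hyperplanes_distinct : injective (fun i => [set x | dot (normal i) x = 0]) }.

Section Faces.
Variables (R : realType) (n : nat) (A : arrangement R n).
Local Notation m := (nhyp A).

Definition hyperplane (i : 'I_m) : set 'cV[R]_n :=
  [set x | dot (normal i) x = 0].

(* Signs: [Some true] is +, [Some false] is -, [None] is 0. *)
Definition side (i : 'I_m) (s : option bool) : set 'cV[R]_n :=
  match s with
  | Some true => [set x | 0 < dot (normal i) x]
  | Some false => [set x | dot (normal i) x < 0]
  | None => hyperplane i
  end.

Definition cell (s : {ffun 'I_m -> option bool}) : set 'cV[R]_n :=
  \bigcap_i side i (s i).

(* Sign vectors with nonempty cell are in bijection with faces as sets, the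
   sides [+], [-], [0] of each hyperplane being pairwise disjoint. *)
Record face := Face {
  sgn : {ffun 'I_m -> option bool};
  face_nonempty : `[< cell sgn !=set0 >] }.

HB.instance Definition _ := [isSub for sgn].
HB.instance Definition _ := [Finite of face by <:].

Definition points (F : face) : set 'cV[R]_n := cell (sgn F).

Record chamber := Chamber {
  face_of :> face;
  chamberP : [forall i, sgn face_of i != None] }.

HB.instance Definition _ := [isSub for face_of].
HB.instance Definition _ := [Finite of chamber by <:].

Definition sgn_mul (s s' : {ffun 'I_m -> option bool}) :
    {ffun 'I_m -> option bool} :=
  [ffun i => if s i is Some e then Some e else s' i].

Lemma face_mul_proof (F F' : face) :
  `[< cell (sgn_mul (sgn F) (sgn F')) !=set0 >].
Proof.
apply/asboolP.
have /asboolP[x Fx] := face_nonempty F.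
have /asboolP[y Fy] := face_nonempty F'.
pose f i z := dot (@normal R n A i) z.
pose M := 1 + \sum_i `|f i y| / `|f i x|.
exists (M *: x + y) => i _.
have fE : f i (M *: x + y) = M * f i x + f i y.
  by rewrite /f /dot mulmxDr -scalemxAr !mxE.
have absM : f i x != 0 -> `|f i y| < M * `|f i x|.
  move=> fx0; have fx_gt0 : 0 < `|f i x| by rewrite normr_gt0.
  rewrite -ltr_pdivrMr// /M (bigD1 i)//= addrCA ltrDl ltr_pwDl//.
  by apply: sumr_ge0 => j _; rewrite divr_ge0.
have := Fx i I; have := Fy i I.
rewrite ffunE /side /hyperplane /=.
case: (sgn F i) => [[|]|] /=.
- rewrite -!/(f i _) fE => _ fx; have := absM (lt0r_neq0 fx).
  rewrite (gtr0_norm fx) ltr_norml => /andP[+ _].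
  by rewrite -subr_gt0 opprK addrC.
- rewrite -!/(f i _) fE => _ fx; have := absM (ltr0_neq0 fx).
  rewrite (ltr0_norm fx) mulrN ltr_norml => /andP[_].
  by rewrite -subr_lt0 opprK addrC.
- move=> + fx; rewrite -/(f i _) in fx.
  by case: (sgn F' i) => [[|]|] /=; rewrite -!/(f i _) fE fx mulr0 add0r.
Qed.

Definition face_mul (F F' : face) : face := Face (face_mul_proof F F').

Lemma chamber_mul_proof (F : face) (C : chamber) :
  [forall i, sgn (face_mul F C) i != None].
Proof.
apply/forallP => i; rewrite ffunE; case: (sgn F i) => [e|] //.
exact: (forallP (chamberP C) i).
Qed.

Definition chamber_mul (F : face) (C : chamber) : chamber :=
  Chamber (chamber_mul_proof F C).

Section Walk.
Variable w : face -> R.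

Definition separating := forall i : 'I_m,
  exists F : face, ~ (points F `<=` hyperplane i) /\ 0 < w F.

(* Law at time t of the walk started at x0: the picked faces F^1, ..., F^t are
   independent with law w, and [foldl] multiplies them on the left of x0,
   F^1 first. *)
Definition walk_prob (t : nat) (x0 x : chamber) : R :=
  \sum_(Fs : t.-tuple face | foldl (fun C F => chamber_mul F C) x0 Fs == x)
    \prod_(F <- Fs) w F.

Definition transition (y x : chamber) : R :=
  \sum_(F : face | chamber_mul F y == x) w F.

End Walk.
End Faces.

Definition prob_dist (R : realType) (T : finType) (p : T -> R) : Prop :=
  (forall x, 0 <= p x) /\ \sum_x p x = 1.

Definition stationary (R : realType) (n : nat) (A : arrangement R n)
    (w : face A -> R) (p : chamber A -> R) : Prop :=
  prob_dist p /\ forall x, p x = \sum_y p y * transition w y x.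

(* The set of chambers is finite and nonempty, so [sup] and [inf] are attained. *)
Definition separation (R : realType) (n : nat) (A : arrangement R n)
    (w : face A -> R) (p : chamber A -> R) (t : nat) : R :=
  sup (range (fun x0 : chamber A =>
    1 - inf (range (fun x : chamber A => walk_prob w t x0 x / p x)))).

Section Action.
Variables (R : realType) (n : nat) (A : arrangement R n) (G : groupType).
Variable rho : G -> 'M[R]_n.

Definition linear_action : Prop :=
  rho 1%g = 1%:M /\ forall g h, rho (g * h)%g = rho g *m rho h.

Definition translate (g : G) (X : set 'cV[R]_n) : set 'cV[R]_n :=
  (fun x => rho g *m x) @` X.

Definition preserves_arrangement : Prop :=
  forall (g : G) (i : 'I_(nhyp A)),
    exists j : 'I_(nhyp A), translate g (hyperplane i) = hyperplane j.

Definition chamber_transitive : Prop :=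
  forall C C' : chamber A, exists g, translate g (points C) = points C'.

Definition invariant_weights (w : face A -> R) : Prop :=
  forall (g : G) (F F' : face A),
    translate g (points F) = points F' -> w F' = w F.

End Action.

(* The inner limits in n need not exist (rounding t n +/- c * r n to an integer
   makes them oscillate), whence the lower and upper limits. [Num.truncn] is the
   integer part, and 0 on negative reals. *)
Definition cutoff (R : realType) (s : nat -> nat -> R) (t r : nat -> R) : Prop :=
  (fun c : R => limn_inf (fun n => s n (Num.truncn (t n - c * r n)))) c
    @[c --> +oo] --> (1 : R) /\
  (fun c : R => limn_sup (fun n => s n (Num.truncn (t n + c * r n)))) c
    @[c --> +oo] --> (0 : R).

Definition logb (R : realType) (a x : R) : R := ln x / ln a.

(* Main.v *)
Require Import Defs.
From HB Require Import structures.
From mathcomp Require Import all_boot all_order all_algebra.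
From mathcomp Require Import all_classical all_reals all_analysis.
From mathcomp Require Import ring lra.
Set Implicit Arguments.
Unset Strict Implicit.
Unset Printing Implicit Defensive.
Import Order.TTheory GRing.Theory Num.Theory.
Import numFieldNormedType.Exports.
Local Open Scope classical_set_scope.
Local Open Scope ring_scope.

(**
  Let [U_t] be the probability that after [t] draws some hyperplane contains
  all the faces drawn. Once every hyperplane has been avoided by a drawn face,
  the position no longer depends on the start, and by symmetry it is then
  equidistributed on the chambers. Hence the stationary law is uniform and
  [P(x0 -> x) >= (1 - U_t) / #chambers], with equality when [x] is opposite to
  [x0], because every sign must then have been overwritten. So the separation
  distance is exactly [U_t].

  The number of hyperplanes still containing all draws has mean
  [mu = m (1 - b)^t]; as [P(F in H_i and H_j) = 1 - 2b + d <= (1 - b)^2], its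
  second moment is at most [mu + mu^2]. Thus [mu / (1 + mu) <= U_t <= mu], and
  [mu] crosses from [e^c] to [O(e^-c)] around [log_(1/(1-b)) m] on the scale
  [1/b], because [b <= - ln (1 - b) <= b / (1 - b)].
*)

(** * Expectations over independent draws *)

Section IidExpectation.
Variables (R : realType) (T : finType) (w : T -> R).
Implicit Types (t : nat) (f g : seq T -> R) (p : pred T).

(** Integrands live on all of [seq T], so that one [f] makes sense for every [t] and the first draw
    can be peeled off. *)
Definition iid_expect t f : R :=
  \sum_(s : t.-tuple T) (\prod_(x <- s) w x) * f s.

Lemma iid_expect0 f : iid_expect 0 f = f [::].
Proof.
rewrite /iid_expect (big_pred1 [tuple]); last first.
  by move=> s; apply/esym/eqP; exact: tuple0.
by rewrite big_nil mul1r.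
Qed.

Lemma iid_expectS t f :
  iid_expect t.+1 f = \sum_x w x * iid_expect t (fun s => f (x :: s)).
Proof.
rewrite /iid_expect.
under [RHS]eq_bigr do rewrite big_distrr /=.
rewrite pair_bigA /=.
rewrite (reindex (fun u : T * t.-tuple T => [tuple of u.1 :: u.2])) /=;
  last first.
  exists (fun s : t.+1.-tuple T => (thead s, [tuple of behead s])).
    by case=> x s _ /=; congr pair; apply: val_inj.
  by move=> s _; apply/esym; exact: tuple_eta.
by apply: eq_bigr => -[x s] _ /=; rewrite big_cons mulrA.
Qed.

Lemma eq_iid_expect t f g : f =1 g -> iid_expect t f = iid_expect t g.
Proof. by move=> fg; apply: eq_bigr => s _; rewrite fg. Qed.

Lemma iid_expectD t f g :
  iid_expect t (fun s => f s + g s) = iid_expect t f + iid_expect t g.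
Proof. by rewrite -big_split; apply: eq_bigr => s _; rewrite mulrDr. Qed.

Lemma iid_expectZ t a f :
  iid_expect t (fun s => a * f s) = a * iid_expect t f.
Proof. by rewrite big_distrr; apply: eq_bigr => s _; rewrite mulrCA. Qed.

Lemma iid_expect_sum (I : finType) t (f : I -> seq T -> R) :
  iid_expect t (fun s => \sum_i f i s) = \sum_i iid_expect t (f i).
Proof.
by rewrite exchange_big; apply: eq_bigr => s _; rewrite big_distrr.
Qed.

Lemma iid_expect_all t p :
  iid_expect t (fun s => (all p s)%:R) = (\sum_(x | p x) w x) ^+ t.
Proof.
elim: t => [|t IH]; first by rewrite iid_expect0.
rewrite iid_expectS exprS -IH big_distrl [RHS]big_mkcond.
apply: eq_bigr => x _ /=; case: (p x) => //=.
by rewrite /iid_expect big1 ?mulr0// => s _; rewrite mulr0.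
Qed.

(** An injection of a finite type is a bijection, so relabelling the draws by a weight-preserving
    [h] leaves their law unchanged. *)
Lemma iid_expect_map t (h : T -> T) f : injective h ->
  (forall x, w (h x) = w x) ->
  iid_expect t (fun s => f (map h s)) = iid_expect t f.
Proof.
move=> h_inj wh; elim: t f => [|t IH] f; first by rewrite !iid_expect0.
rewrite !iid_expectS [RHS](reindex_inj h_inj).
by apply: eq_bigr => x _; rewrite wh -[in RHS]IH.
Qed.

Hypothesis w_ge0 : forall x, 0 <= w x.

Lemma le_iid_expect t f g : (forall s, f s <= g s) ->
  iid_expect t f <= iid_expect t g.
Proof.
move=> fg; apply: ler_sum => s _; apply: ler_wpM2l => //.
by apply: prodr_ge0 => x _.
Qed.

Hypothesis w_sum1 : \sum_x w x = 1.

Lemma iid_expect_cst t a : iid_expect t (fun=> a) = a.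
Proof.
rewrite -[RHS]mulr1 -(expr1n R t) -w_sum1 -(iid_expect_all t xpredT).
by rewrite -iid_expectZ; apply: eq_iid_expect => s; rewrite all_predT mulr1.
Qed.

(** * First and second moment bounds *)

Section FirstAndSecondMoment.
Variables (I : finType) (P : I -> pred T) (q : R).
Hypothesis P_mass : forall i, \sum_(x | P i x) w x = q.

Definition some_all (s : seq T) : bool := [exists i, all (P i) s].

Let mu t : R := #|I|%:R * q ^+ t.

Let expect_count t :
  iid_expect t (fun s => \sum_i (all (P i) s)%:R) = mu t.
Proof.
rewrite iid_expect_sum; under eq_bigr do rewrite iid_expect_all P_mass.
by rewrite sumr_const /mu mulr_natl.
Qed.

(** Markov's inequality: the indicator is at most the number of [i] whose predicate holds on all
    draws. *)
Lemma iid_expect_some_all_le t : iid_expect t (fun s => (some_all s)%:R) <=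
  mu t.
Proof.
rewrite -expect_count; apply: le_iid_expect => s.
case: (boolP (some_all s)) => [/existsP[i Pi]|_]; last by apply: sumr_ge0.
by rewrite (bigD1 i)//= Pi lerDl; apply: sumr_ge0.
Qed.

Hypothesis PI_mass :
  forall i j, i != j -> \sum_(x | P i x && P j x) w x <= q ^+ 2.

(** The square is a sum over pairs. The diagonal yields [mu t]; an off-diagonal pair gives at most
    [(q ^+ 2) ^+ t], and allowing this amount on the diagonal too completes [mu t ^+ 2]. *)
Let expect_count_sqr t :
  iid_expect t (fun s => (\sum_i (all (P i) s)%:R) ^+ 2) <= mu t + mu t ^+ 2.
Proof.
have -> : mu t + mu t ^+ 2 =
    \sum_(i : I) \sum_(j : I) ((i == j)%:R * q ^+ t + (q ^+ 2) ^+ t).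
  under eq_bigr => i _.
    rewrite big_split /= (bigD1 i)//= eqxx mul1r big1 ?addr0; last first.
      by move=> j /negbTE; rewrite eq_sym => ->; rewrite mul0r.
    rewrite sumr_const.
  over.
  rewrite sumr_const /= /mu !mulr_natl mulrnDl -!exprM mulnC exprM;
    congr (_ + _).
  by rewrite exprMn_n -mulrnA.
under eq_iid_expect do rewrite expr2 big_distrlr.
rewrite iid_expect_sum; apply: ler_sum => i _.
rewrite iid_expect_sum; apply: ler_sum => j _.
under eq_iid_expect do rewrite /= -natrM mulnb -all_predI.
rewrite iid_expect_all /=.
have q0 : 0 <= q by rewrite -(P_mass i); apply: sumr_ge0.
have [->|ij] := eqVneq i j.
  rewrite mul1r -[leLHS]addr0 lerD ?exprn_ge0//.
  by under eq_bigl do rewrite andbb; rewrite P_mass.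
rewrite mul0r add0r; apply: lerXn2r; rewrite ?nnegrE ?exprn_ge0 ?PI_mass//.
by apply: sumr_ge0.
Qed.

(* Second-moment method: for the number [N] of [i] such that all draws lie in
   [P i], expand [0 <= E[(N / (1 + mu) - 1)^2; N > 0]]. *)
Lemma iid_expect_some_all_ge t :
  mu t <= (1 + mu t) * iid_expect t (fun s => (some_all s)%:R).
Proof.
have mu0 : 0 <= mu t.
  by rewrite -expect_count /iid_expect; apply: sumr_ge0 => s _;
    rewrite mulr_ge0 ?prodr_ge0 ?sumr_ge0.
set U := iid_expect t _; pose N s : R := \sum_i (all (P i) s)%:R.
pose l := (1 + mu t)^-1.
have l_gt0 : 0 < l by rewrite invr_gt0 ltr_pwDl.
have : 0 <= iid_expect t (fun s => l ^+ 2 * N s ^+ 2 + ((- 2 * l) * N s +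
  (some_all s)%:R)).
  rewrite -(iid_expect_cst t 0); apply: le_iid_expect => s.
  case: (boolP (some_all s)) => [_|/existsPn Ns]; last first.
    by rewrite /N big1 ?mulr0 ?expr0n ?mulr0 ?addr0// => i _;
      rewrite (negbTE (Ns i)).
  have -> : l ^+ 2 * N s ^+ 2 + ((- 2 * l) * N s + 1) =
    (l * N s - 1) ^+ 2 by ring.
  exact: sqr_ge0.
rewrite 2!iid_expectD !iid_expectZ expect_count -/U => h.
have {h} : 0 <= l ^+ 2 * (mu t + mu t ^+ 2) + (- 2 * l * mu t + U).
  apply: le_trans h _; rewrite lerD2r ler_wpM2l ?sqr_ge0//;
    exact: expect_count_sqr.
have -> : l ^+ 2 * (mu t + mu t ^+ 2) = l * mu t.
  by rewrite /l; field; rewrite gt_eqF ?ltr_pwDl.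
have -> : l * mu t + (- 2 * l * mu t + U) = U - l * mu t by ring.
by rewrite subr_ge0 /l mulrC ler_pdivrMr ?ltr_pwDl// mulrC.
Qed.

End FirstAndSecondMoment.
End IidExpectation.

(** * Faces as sign vectors *)

Section SignVectors.
Variables (R : realType) (n : nat).

Lemma dotDr (a x y : 'cV[R]_n) : dot a (x + y) = dot a x + dot a y.
Proof. by rewrite /dot mulmxDr mxE. Qed.

Lemma dotZr (a x : 'cV[R]_n) k : dot a (k *: x) = k * dot a x.
Proof. by rewrite /dot -scalemxAr mxE. Qed.

Lemma dotNr (a x : 'cV[R]_n) : dot a (- x) = - dot a x.
Proof. by rewrite -scaleN1r dotZr mulN1r. Qed.

Lemma dot_self_eq0 (a : 'cV[R]_n) : (dot a a == 0) = (a == 0).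
Proof.
apply/eqP/eqP => [|->]; last by rewrite /dot mulmx0 mxE.
rewrite /dot mxE => /eqP; under eq_bigr do rewrite mxE.
rewrite psumr_eq0 => [/allP a0|i _]; last by rewrite -expr2 sqr_ge0.
apply/matrixP => i j; rewrite ord1 mxE; apply/eqP.
by have := a0 i (mem_index_enum i); rewrite /= mulf_eq0 orbb.
Qed.

(** The vector [x - (dot a x / dot a a) *: a] lies in the kernel of [dot a], so [L] only sees the
    component of [x] along [a]. *)
Lemma dot_kernel_sub (a : 'cV[R]_n) (L : {linear 'cV[R]_n -> R^o}) : a != 0 ->
  (forall x, dot a x = 0 -> L x = 0) ->
  forall x, L x = L a / dot a a * dot a x.
Proof.
move=> a0 kerL x; have aa0 : dot a a != 0 by rewrite dot_self_eq0.
have : L (x - (dot a x / dot a a) *: a) = 0.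
  by apply: kerL; rewrite dotDr dotNr dotZr divfK ?subrr.
rewrite linearB linearZ /= => /eqP; rewrite subr_eq0 => /eqP ->.
by rewrite -[LHS]/(dot a x / dot a a * L a) mulrC mulrA mulrAC.
Qed.

Definition sign_of (y : R) : option bool :=
  if 0 < y then Some true else if y < 0 then Some false else None.

Definition sign_mul (k : R) (s : option bool) : option bool :=
  if 0 < k then s else omap negb s.

Lemma sign_ofM (k y : R) : k != 0 -> sign_of (k * y) = sign_mul k (sign_of y).
Proof.
rewrite neq_lt /sign_of /sign_mul => /orP[k0|k0].
  rewrite nmulr_rgt0// nmulr_rlt0// (lt_gtF k0).
  by case: ltgtP.
by rewrite pmulr_rgt0// pmulr_rlt0// k0; case: ltgtP.
Qed.

Variable A : arrangement R n.
Implicit Types (F : face A) (C : chamber A) (i : 'I_(nhyp A)).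

Lemma sideE i s x : side i s x <-> s = sign_of (dot (normal i) x).
Proof.
rewrite /sign_of; set y := dot _ _.
by case: s => [[]|]; rewrite /side/hyperplane/= -/y;
  case: (ltgtP 0 y) => [y0|y0|y0]; split=> // y0'; rewrite ?y0// y0' ltxx in y0.
Qed.

Lemma cellP (s : {ffun 'I_(nhyp A) -> option bool}) x :
  cell s x <-> forall i, s i = sign_of (dot (normal i) x).
Proof.
split => [sx i|sx i _]; first exact/sideE/sx.
exact/sideE.
Qed.

Lemma points_nonempty F : exists x, points F x.
Proof. by have /asboolP := face_nonempty F. Qed.

Lemma points_inj : injective (@points R n A).
Proof.
move=> F F' FF'; apply: val_inj; apply/ffunP => i /=.
have [x Fx] := points_nonempty F; have := Fx; rewrite FF' => F'x.
by move/cellP : Fx => ->; move/cellP : F'x => ->.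
Qed.

Lemma chamber_sgn C i : sgn C i != None.
Proof. exact: (forallP (chamberP C)). Qed.

(** All points of a face have the same sign at [i], so a single point decides the inclusion. *)
Lemma points_not_subset_hyperplane F i :
  ~~ `[< points F `<=` hyperplane i >] = (sgn F i != None).
Proof.
congr (~~ _); apply/asboolP/eqP => [FH|Fi x /(_ i I)]; last by rewrite Fi.
have [x Fx] := points_nonempty F; move/cellP : (Fx) => ->.
exact/esym/(sideE i None)/FH.
Qed.

Lemma points_not_subset_hyperplaneU F i j :
  ~~ `[< points F `<=` hyperplane i `|` hyperplane j >] =
  (sgn F i != None) && (sgn F j != None).
Proof.
rewrite -!points_not_subset_hyperplane -negb_or; congr (~~ _).
apply/asboolP/orP => [FH|].
  have [x Fx] := points_nonempty F.
  by case: (FH _ Fx) => Hx; [left|right];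
    rewrite -[`[< _ >]]negbK points_not_subset_hyperplane
    negbK; apply/eqP; move/cellP : Fx => ->; apply/esym/(sideE _ None).
by case=> /asboolP FH x /FH; [left|right].
Qed.

(** Negating a point of [C] flips every sign, and no sign of a chamber is 0. *)
Lemma opposite_chamber C : exists C', forall i, sgn C' i != sgn C i.
Proof.
have [x Cx] := points_nonempty C.
pose s : {ffun 'I_(nhyp A) -> option bool} := [ffun i => omap negb (sgn C i)].
have sN : cell s (- x).
  apply/cellP => i; rewrite ffunE dotNr -mulN1r sign_ofM ?oppr_eq0 ?oner_eq0//.
  by rewrite /sign_mul ltr0N1; congr omap; move/cellP : Cx; exact.
have sF : `[< cell s !=set0 >] by apply/asboolP; exists (- x).
have sC : [forall i, sgn (Face sF) i != None].
  by apply/forallP => i; rewrite ffunE; case: (sgn C i) (chamber_sgn C i).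
exists (Chamber sC) => i; rewrite /= ffunE.
by case: (sgn C i) (chamber_sgn C i) => // -[].
Qed.

(** * The group action on hyperplanes and faces *)

Section Symmetry.
Variables (G : groupType) (rho : G -> 'M[R]_n).
Hypothesis rho_action : linear_action rho.
Hypothesis rho_arr : preserves_arrangement A rho.

Lemma rhoK g : cancel (mulmx (rho g) : 'cV_n -> 'cV_n) (mulmx (rho g^-1%g)).
Proof.
case: rho_action => rho1 rhoM x.
by rewrite mulmxA -rhoM mulVg rho1 mul1mx.
Qed.

Lemma rhoVK g : cancel (mulmx (rho g^-1%g) : 'cV_n -> 'cV_n) (mulmx (rho g)).
Proof.
case: rho_action => rho1 rhoM x.
by rewrite mulmxA -rhoM mulgV rho1 mul1mx.
Qed.

Lemma translate_inj g : injective (translate rho g).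
Proof.
have sub X Y : translate rho g X `<=` translate rho g Y -> X `<=` Y.
  move=> XY x Xx; have [y Yy] : translate rho g Y (rho g *m x) by apply: XY;
    exists x.
  by move=> /(can_inj (rhoK g)) <-.
by move=> X Y XY; apply/seteqP; split; apply: sub; rewrite XY.
Qed.

(** The form [x |-> dot (normal (sigma i)) (rho g *m x)] vanishes on hyperplane [i], hence is a
    multiple of [dot (normal i)]. *)
Lemma normal_translate g : exists2 sigma : 'I_(nhyp A) -> 'I_(nhyp A),
  injective sigma & exists k : 'I_(nhyp A) -> R, (forall i, k i != 0) /\
    forall i x, dot (normal (sigma i)) (rho g *m x) = k i * dot (normal i) x.
Proof.
have /choice[sigma sigmaP] := rho_arr g.
exists sigma.
  move=> i j ij; apply: (@hyperplanes_distinct _ _ A).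
  by apply: (@translate_inj g); rewrite [LHS]sigmaP [RHS]sigmaP ij.
pose L i := fun x : 'cV[R]_n => dot (normal (sigma i)) (rho g *m x) : R^o.
have L_lin i : linear (L i).
  by move=> a x y; rewrite /L mulmxDr -scalemxAr dotDr dotZr.
pose M i := GRing.isLinear.Build _ _ _ _ (L i) (L_lin i).
pose LL i : {linear 'cV[R]_n -> R^o} := HB.pack (L i) (M i).
have LE i x : L i x =
  L i (normal i) / dot (normal i) (normal i) * dot (normal i) x.
  apply: (@dot_kernel_sub _ (LL i)); first exact: normal_neq0.
  move=> y iy; have : translate rho g (hyperplane i) (rho g *m y) by exists y.
  by rewrite sigmaP.
exists (fun i => L i (normal i) / dot (normal i) (normal i)); split=> // i.
(* At this vector the form equals the squared norm of a normal vector, so the factor cannot be 0. *)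
apply/eqP => k0; have := LE i (rho g^-1%g *m normal (sigma i)).
rewrite k0 mul0r /L rhoVK => /eqP; rewrite dot_self_eq0.
by rewrite (negbTE (normal_neq0 _)).
Qed.

(** The sign of [f F] at [sigma i] is that of [F] at [i], flipped or not according to [k i] alone.
    Flips common to all faces commute with the product and fix the sign 0. *)
Lemma face_translate g : exists f : face A -> face A,
  [/\ forall F, translate rho g (points F) = points (f F),
      forall F F', f (face_mul F F') = face_mul (f F) (f F') &
      exists2 sigma : 'I_(nhyp A) -> 'I_(nhyp A), injective sigma &
        forall F i, (sgn (f F) (sigma i) == None) = (sgn F i == None)].
Proof.
have [sigma sigma_inj [k [k0 kE]]] := normal_translate g.
pose tau := invF sigma_inj.
pose act (s : {ffun 'I_(nhyp A) -> option bool}) :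
  {ffun 'I_(nhyp A) -> option bool} :=
  [ffun j => sign_mul (k (tau j)) (s (tau j))].
have actE s i : act s (sigma i) =
  sign_mul (k i) (s i) by rewrite ffunE /tau invF_f.
have act_cell s : translate rho g (cell s) = cell (act s).
  apply/seteqP; split => [_ [x /cellP sx <-]|y /cellP sy].
    apply/cellP => j; rewrite -(f_invF sigma_inj j) actE kE sign_ofM ?k0//.
    by rewrite sx.
  exists (rho g^-1%g *m y); last by rewrite rhoVK.
  apply/cellP => i; have := sy (sigma i); rewrite actE -{1}(rhoVK g y) kE.
  rewrite sign_ofM ?k0// /sign_mul; case: ifP => // _.
  by case: (s i) => [[]|]; case: (sign_of _) => [[]|].
have act_ne F : `[< cell (act (sgn F)) !=set0 >].
  apply/asboolP; rewrite -act_cell; have [x Fx] := points_nonempty F.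
  by exists (rho g *m x), x.
exists (fun F => Face (act_ne F)); split.
- by move=> F; exact: act_cell.
- move=> F F'; apply: val_inj; apply/ffunP => j; rewrite /= !ffunE.
  by rewrite /sign_mul; case: ifP => _; case: (sgn F _).
- exists sigma => // F i; rewrite /= actE /sign_mul; case: ifP => _ //.
  by case: (sgn F i).
Qed.

End Symmetry.
End SignVectors.

(** * The walk as a function of the drawn faces *)

Section Walk.
Variables (R : realType) (n : nat) (A : arrangement R n).
Implicit Types (F : face A) (x y : chamber A) (i : 'I_(nhyp A)).
Implicit Types (s : seq (face A)) (t : nat).

Definition run x s : chamber A := foldl (fun C F => chamber_mul F C) x s.

Definition in_hyperplane i : pred (face A) := fun F => sgn F i == None.

Definition unseparated s : bool := some_all in_hyperplane s.

Lemma sgn_run_in x s i : all (in_hyperplane i) s -> sgn (run x s) i = sgn x i.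
Proof.
elim: s x => [//|F s IH] x /= /andP[/eqP Fi si].
by rewrite -/(run _ _) IH//= ffunE Fi.
Qed.

(** The last drawn face off hyperplane [i] dictates the sign at [i], overwriting whatever came
    before. *)
Lemma sgn_run_notin x y s i : ~~ all (in_hyperplane i) s ->
  sgn (run x s) i = sgn (run y s) i.
Proof.
elim: s x y => [//|F s IH] x y /=; rewrite -!/(run _ _).
have [si|si _] := boolP (all _ s); last exact: IH.
rewrite andbT !sgn_run_in//= !ffunE /in_hyperplane.
by case: (sgn F i).
Qed.

Lemma run_separated x y s : ~~ unseparated s -> run x s = run y s.
Proof.
move=> /existsPn sep; do 2!apply: val_inj; apply/ffunP => i /=.
exact: sgn_run_notin.
Qed.

Lemma run_opposite x y s : (forall i, sgn y i != sgn x i) ->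
  run x s = y -> ~~ unseparated s.
Proof.
move=> xy xs; apply/existsPn => i; apply/negP => /(sgn_run_in x).
by rewrite xs; apply/eqP; exact: xy.
Qed.

Variable w : face A -> R.
Local Notation E := (iid_expect w).

Definition unseparated_prob t : R := E t (fun s => (unseparated s)%:R).

(* For a separated list [s] the start of [run] is irrelevant, so starting it at
   its own target loses nothing and avoids choosing a base chamber. *)
Definition hit t x : R :=
  E t (fun s => (~~ unseparated s && (run x s == x))%:R).

Lemma walk_probE t x y : walk_prob w t x y = E t (fun s => (run x s == y)%:R).
Proof.
rewrite /walk_prob big_mkcond; apply: eq_bigr => s _.
by rewrite -/(run _ _); case: (run _ _ == _); rewrite ?mulr1 ?mulr0.
Qed.

(** Writes [p x] as an average over starts, so that bounds uniform in the start pass to [p]. *)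
Lemma walk_prob_stationary p t x : stationary w p ->
  p x = \sum_y p y * walk_prob w t y x.
Proof.
move=> [_ pE]; under eq_bigr do rewrite walk_probE.
elim: t => [|t IH].
  rewrite (bigD1 x)//= iid_expect0 eqxx mulr1 big1 ?addr0// => y yx.
  by rewrite iid_expect0 (negbTE yx) mulr0.
rewrite {}IH; under eq_bigr do rewrite pE.
under eq_bigr do rewrite big_distrl.
rewrite exchange_big; apply: eq_bigr => y _ /=.
rewrite iid_expectS big_distrr /=.
under eq_bigr do rewrite /transition -mulrA.
rewrite -big_distrr /=.
rewrite -[RHS]big_distrr/=; congr (_ * _).
rewrite (partition_big (fun F => chamber_mul F y) xpredT)//=.
apply: eq_bigr => z _; rewrite big_distrl /=.
by apply: eq_bigr => F /eqP <-.
Qed.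

(** * Comparison of the walk with [hit] *)

Section Distribution.
Hypothesis w_dist : prob_dist w.

Let w_ge0 F : 0 <= w F. Proof. by case: w_dist. Qed.
Let w_sum1 : \sum_F w F = 1. Proof. by case: w_dist. Qed.

Lemma unseparated_prob_ge0 t : 0 <= unseparated_prob t.
Proof. by rewrite -(iid_expect_cst w_sum1 t 0); exact: le_iid_expect. Qed.

Lemma unseparated_prob_le1 t : unseparated_prob t <= 1.
Proof.
rewrite -(iid_expect_cst w_sum1 t 1); apply: le_iid_expect => // s.
by rewrite lern1 leq_b1.
Qed.

Lemma hit_le_walk_prob t x y : hit t y <= walk_prob w t x y.
Proof.
rewrite walk_probE; apply: le_iid_expect => // s; rewrite ler_nat.
by have [|/(run_separated x y) ->] := boolP (unseparated s).
Qed.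

(** The endpoint depends on the start only for unseparated lists, whose total mass is the error
    term. *)
Lemma walk_prob_le_hit t x y :
  walk_prob w t x y <= hit t y + unseparated_prob t.
Proof.
rewrite walk_probE -iid_expectD; apply: le_iid_expect => // s.
rewrite -natrD ler_nat.
have [|/(run_separated x y) ->] := boolP (unseparated s); last by rewrite addn0.
by rewrite add0n leq_b1.
Qed.

Lemma walk_prob_opposite t x y : (forall i, sgn y i != sgn x i) ->
  walk_prob w t x y = hit t y.
Proof.
move=> xy; rewrite walk_probE; apply: eq_iid_expect => s;
  congr (nat_of_bool _)%:R.
have [us|/(run_separated x y) ->//] := boolP (unseparated s).
by apply/negP => /eqP /(run_opposite xy); rewrite us.
Qed.

(** A separated list has one endpoint common to all starts, so it counts for exactly one [x]; the
    given chamber serves to name that endpoint. *)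
Lemma hit_sum t : chamber A -> \sum_x hit t x = 1 - unseparated_prob t.
Proof.
move=> x0; rewrite -[X in X - _](iid_expect_cst w_sum1 t) -mulN1r -iid_expectZ.
rewrite -iid_expectD /hit -iid_expect_sum; apply: eq_iid_expect => s.
have [us|us] := boolP (unseparated s).
  by rewrite big1// mulN1r subrr.
rewrite mulr0 addr0 (bigD1 (run x0 s))//= (run_separated _ x0 us) eqxx.
rewrite big1 ?addr0// => x; rewrite (run_separated x x0 us).
by rewrite eq_sym => /negbTE ->.
Qed.

End Distribution.

(** * Uniformity of the stationary law and the separation distance *)

Section Symmetry.
Variables (G : groupType) (rho : G -> 'M[R]_n).
Hypothesis rho_action : linear_action rho.
Hypothesis rho_arr : preserves_arrangement A rho.
Hypothesis rho_trans : chamber_transitive A rho.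
Hypothesis w_inv : invariant_weights rho w.

(** A group element taking [x] to [y] induces a map [f] of faces compatible with products.
    Relabelling draws by [f] preserves weights and separatedness, and turns runs ending at [x] into
    runs ending at [y]. *)
Lemma hit_const t x y : hit t x = hit t y.
Proof.
have [g gxy] := rho_trans x y.
have [f [fE fM [sigma sigma_inj fsigma]]] :=
  face_translate rho_action rho_arr g.
have f_inj : injective f.
  move=> F F' ff; apply/points_inj/(translate_inj rho_action (g := g)).
  by rewrite !fE ff.
have in_f i F : in_hyperplane (sigma i) (f F) =
  in_hyperplane i F by exact: fsigma.
have fC (z : chamber A) : [forall i, sgn (f z) i != None].
  apply/forallP => j; rewrite -(f_invF sigma_inj j).
  by rewrite fsigma chamber_sgn.
pose fc (z : chamber A) := Chamber (fC z).
have fc_inj : injective fc by move=> z z' /(congr1 val) /f_inj /val_inj.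
have fcx : fc x = y by apply/val_inj/points_inj; rewrite /= -fE.
have run_f z s : run (fc z) (map f s) = fc (run z s).
  elim: s z => [//|F s IH] z /=; rewrite -!/(run _ _) -IH; congr run.
  by apply: val_inj; rewrite /= -fM; congr f; apply: val_inj.
have un_f s : unseparated (map f s) = unseparated s.
  apply/existsP/existsP => -[i]; rewrite ?all_map.
    by rewrite -(f_invF sigma_inj i) (eq_all (in_f _));
      exists (invF sigma_inj i).
  by exists (sigma i); rewrite all_map (eq_all (in_f _)).
rewrite {2}/hit -(iid_expect_map _ _ f_inj); last by move=> F;
  exact: w_inv (fE F).
apply: eq_iid_expect => s.
by rewrite un_f -fcx run_f (inj_eq fc_inj).
Qed.

Hypothesis w_dist : prob_dist w.
Hypothesis unseparated_cvg : unseparated_prob t @[t --> \oo] --> (0 : R).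

Lemma hitE t x : hit t x = (1 - unseparated_prob t) / #|{: chamber A}|%:R.
Proof.
have N0 : #|{: chamber A}|%:R != 0 :> R.
  by rewrite pnatr_eq0 -lt0n; apply/card_gt0P; exists x.
apply/(canRL (mulfK N0)); rewrite -(hit_sum w_dist t x) mulr_natr.
by under [RHS]eq_bigr do rewrite (hit_const t _ x); rewrite sumr_const.
Qed.

(** As an average over starts, [p x] lies between [hit t x] and [hit t x + unseparated_prob t],
    which both tend to the uniform value. *)
Lemma stationary_uniform p x : stationary w p -> p x = #|{: chamber A}|%:R^-1.
Proof.
move=> p_stat; have [[p_ge0 p_sum1] _] := p_stat.
set N : R := #|{: chamber A}|%:R.
have N1 : 1 <= N by rewrite /N ler1n; apply/card_gt0P; exists x.
have NV1 : N^-1 <= 1 by rewrite invf_le1// (lt_le_trans _ N1).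
have NV0 : 0 <= N^-1 by rewrite invr_ge0 (le_trans _ N1).
have close t : `|p x - N^-1| <= unseparated_prob t.
  have hx : hit t x <= p x.
    rewrite (walk_prob_stationary t x p_stat) -[leLHS]mul1r -p_sum1 big_distrl.
    by apply: ler_sum => y _; apply: ler_wpM2l => //; exact: hit_le_walk_prob.
  have xh : p x <= hit t x + unseparated_prob t.
    rewrite (walk_prob_stationary t x p_stat) -[leRHS]mul1r -p_sum1 big_distrl.
    by apply: ler_sum => y _; apply: ler_wpM2l => //; exact: walk_prob_le_hit.
  move: hx xh; rewrite hitE -/N mulrBl mul1r => hx xh.
  have U0 := unseparated_prob_ge0 w_dist t.
  have UN : 0 <= unseparated_prob t / N <= unseparated_prob t.
    by rewrite mulr_ge0//= ler_piMr.
  by rewrite ler_norml; lra.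
apply/eqP; rewrite -subr_eq0 -normr_le0.
rewrite -(cvg_lim _ unseparated_cvg)//; apply: limr_ge; first by apply/cvg_ex;
  exists 0.
by apply: nearW => t; exact: close.
Qed.

(** Every ratio is at least [1 - unseparated_prob t], with equality at the chamber opposite to the
    start; the infimum is thus the same for all starts. *)
Lemma separationE p t : stationary w p -> separation w p t = unseparated_prob t.
Proof.
move=> p_stat; have [[p_ge0 p_sum1] _] := p_stat.
have [x0] : exists x0 : chamber A, true.
  case: (pickP (@predT (chamber A))) => [x _|e]; first by exists x.
  by move: p_sum1; rewrite big_pred0// => /esym/eqP; rewrite oner_eq0.
move=> _; set N : R := #|{: chamber A}|%:R.
have N0 : 0 < N by rewrite /N ltr0n; apply/card_gt0P; exists x0.
have infE x : inf (range (fun y => walk_prob w t x y / p y)) =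
  1 - unseparated_prob t.
  have ratio y : hit t y / p y = 1 - unseparated_prob t.
    by rewrite hitE (stationary_uniform y p_stat) invrK mulfVK// gt_eqF.
  have lb y : 1 - unseparated_prob t <= walk_prob w t x y / p y.
    rewrite -(ratio y) ler_wpM2r ?invr_ge0//; exact: hit_le_walk_prob.
  apply/eqP; rewrite eq_le; apply/andP; split.
    have [y xy] := opposite_chamber x.
    rewrite -(ratio y) -(walk_prob_opposite t xy).
    apply: ge_inf; last by exists y.
    by exists (1 - unseparated_prob t) => _ [z _ <-].
  apply: lb_le_inf; first by exists (walk_prob w t x x0 / p x0), x0.
  by move=> _ [z _ <-].
rewrite /separation; under eq_fun do rewrite infE subKr.
rewrite (_ : range _ = [set unseparated_prob t]) ?sup1//.
apply/seteqP; split => [_ [z _ <-]//|_ ->]; by exists x0.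
Qed.

End Symmetry.

(** * Moment bounds in terms of [b] and [d] *)

Section Moments.
Variables (b d : R).
Hypothesis w_dist : prob_dist w.
Hypothesis b_mass : forall i,
  b = \sum_(F | ~~ `[< points F `<=` hyperplane i >]) w F.
Hypothesis d_mass : forall i j, i != j ->
  \sum_(F | ~~ `[< points F `<=` hyperplane i `|` hyperplane j >]) w F = d.
Hypothesis d_le : d <= b ^+ 2.

Let w_ge0 F : 0 <= w F. Proof. by case: w_dist. Qed.
Let w_sum1 : \sum_F w F = 1. Proof. by case: w_dist. Qed.

Let in_mass i : \sum_(F | in_hyperplane i F) w F = 1 - b.
Proof.
rewrite (b_mass i) -w_sum1 (bigID (in_hyperplane i) xpredT) /=.
by under [X in _ - X]eq_bigl do rewrite points_not_subset_hyperplane;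
  rewrite addrK.
Qed.

Let in2_mass i j : i != j ->
  \sum_(F | in_hyperplane i F && in_hyperplane j F) w F <= (1 - b) ^+ 2.
Proof.
move=> ij.
have -> : \sum_(F | in_hyperplane i F && in_hyperplane j F) w F =
  1 - b - (b - d).
  rewrite -(in_mass i) [in RHS](bigID (in_hyperplane j))/=.
  (* [b] is the mass off hyperplane [j] and [d] the mass off both, so the difference is the mass in
     [i] and off [j]. *)
  suff -> : b - d = \sum_(F | in_hyperplane i F && ~~ in_hyperplane j F) w F.
    by rewrite addrK.
  rewrite (b_mass j) -(d_mass ij).
  under eq_bigl do rewrite points_not_subset_hyperplane.
  under [X in _ - X]eq_bigl do rewrite points_not_subset_hyperplaneU.
  rewrite (bigID (in_hyperplane i))/= -[RHS]addr0 -addrA; congr (_ + _).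
    by apply: eq_bigl => F; rewrite andbC.
  by apply/eqP; rewrite subr_eq0; apply/eqP/eq_bigl => F; rewrite andbC.
by move: d_le; rewrite !expr2; lra.
Qed.

Lemma unseparated_prob_le t : unseparated_prob t <= (nhyp A)%:R * (1 - b) ^+ t.
Proof.
by have := iid_expect_some_all_le w_ge0 in_mass t; rewrite card_ord.
Qed.

Lemma unseparated_prob_ge t (mu := (nhyp A)%:R * (1 - b) ^+ t) :
  mu <= (1 + mu) * unseparated_prob t.
Proof.
by have := iid_expect_some_all_ge w_ge0 w_sum1 in_mass in2_mass t;
  rewrite card_ord.
Qed.

(** The empty list lies in every hyperplane. This serves the times before cutoff that truncate to
    0. *)
Lemma unseparated_prob0 : (0 < nhyp A)%N -> unseparated_prob 0 = 1.
Proof.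
move=> m0; rewrite /unseparated_prob iid_expect0.
suff -> : unseparated [::] by [].
by apply/existsP; exists (Ordinal m0).
Qed.

Lemma unseparated_prob_cvg0 : 0 < b -> b <= 1 ->
  unseparated_prob t @[t --> \oo] --> (0 : R).
Proof.
move=> b0 b1.
apply: (@squeeze_cvgr _ _ _ _ (cst 0) (fun t => (nhyp A)%:R * (1 - b) ^+ t)).
- by apply: nearW => t; rewrite unseparated_prob_ge0//= unseparated_prob_le.
- exact: cvg_cst.
- rewrite -[X in _ --> X](mulr0 (nhyp A)%:R); apply: cvgMr.
  apply: cvg_expr; rewrite ger0_norm ?subr_ge0//; lra.
Qed.

End Moments.
End Walk.

(** * Limits superior and inferior of eventually bounded sequences *)

Lemma sups_eventually_bounded (R : realType) (n0 : nat) (l h : R) (u :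
  nat -> R) :
  (forall n, (n0 <= n)%N -> l <= u n <= h) ->
  cvgn (sups u) /\ l <= limn_sup u <= h.
Proof.
move=> ub.
have has n : (n0 <= n)%N -> has_sup (sdrop u n).
  move=> n0n; split; first by exists (u n), n => /=.
  by exists h => _ [k /= nk <-]; case/andP: (ub k (leq_trans n0n nk)).
have sups_l n : (n0 <= n)%N -> l <= sups u n.
  move=> n0n; apply: (le_trans (proj1 (andP (ub n n0n)))).
  by apply: ub_le_sup; [case: (has n n0n)|exists n => /=].
have sups_h n : (n0 <= n)%N -> sups u n <= h.
  move=> n0n; apply: ge_sup; first by case: (has n n0n).
  by move=> _ [k /= nk <-]; case/andP: (ub k (leq_trans n0n nk)).
(* [lim] has a default value on divergent sequences, so convergence comes first: from [n0] on, the
   tail suprema decrease and stay above [l]. *)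
have cvg_sups : cvgn (sups u).
  apply: (@near_nonincreasing_is_cvgn _ _ l); last by exists n0 => // n /=;
    exact: sups_l.
  exists n0 => // k /= n0k j kj; apply: sup_le.
  - by move=> _ [i /= ji <-]; apply/downP; exists (u i) => //=; exists i => //;
      exact: leq_trans kj ji.
  - by exists (u j), j => /=.
  - exact: has.
by split=> //; rewrite limr_ge ?limr_le//; exists n0.
Qed.

Lemma limn_inf_bounds (R : realType) (n0 : nat) (l h : R) (u : nat -> R) :
  (forall n, (n0 <= n)%N -> l <= u n <= h) -> l <= limn_inf u <= h.
Proof.
move=> ub; have [|cvg_supsN] :=
  @sups_eventually_bounded R n0 (- h) (- l) (-%R \o u).
  by move=> n /ub; rewrite !lerN2 andbC.
rewrite /limn_sup /limn_inf -[infs u]opprK -supsN limN//.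
by rewrite lerNl lerNr andbC.
Qed.

(** * The mean count around the cutoff time *)

Section Asymptotics.
Variables (R : realType) (b c : R) (m : nat).
Hypotheses (b_gt0 : 0 < b) (b_lt1 : b < 1) (m_gt0 : (0 < m)%N) (c_ge0 : 0 <= c).
Let L : R := - ln (1 - b).
Let t0 : R := logb (1 / (1 - b)) m%:R.

Lemma le_neg_ln1B : b <= - ln (1 - b).
Proof. by rewrite lerNr le_ln1Dx// ltrN2. Qed.

(** This is [ln (1 + x) <= x] at [x = b / (1 - b)], for which [1 + x = (1 - b)^-1]. *)
Lemma neg_ln1B_le : - ln (1 - b) <= b / (1 - b).
Proof.
have B_gt0 : 0 < 1 - b by rewrite subr_gt0.
rewrite -lnV ?posrE// [X in ln X](_ : _ = 1 + b / (1 - b)).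
  by rewrite le_ln1Dx// (lt_trans (ltrN10 R))// divr_gt0.
by field; rewrite gt_eqF.
Qed.

Let L_gt0 : 0 < L. Proof. exact: lt_le_trans b_gt0 le_neg_ln1B. Qed.

Let ltB : 0 < 1 - b. Proof. by rewrite subr_gt0. Qed.

Lemma ln_inv1B : ln (1 / (1 - b)) = L.
Proof. by rewrite div1r lnV// posrE. Qed.

Let L_t0 : L * t0 = ln m%:R.
Proof. by rewrite /t0 /logb ln_inv1B mulrC divfK// gt_eqF. Qed.

Lemma logb_ge0 : 0 <= t0.
Proof. by rewrite /t0 /logb ln_inv1B divr_ge0 ?ln_ge0 ?ler1n// ltW. Qed.

Let meanE t : m%:R * (1 - b) ^+ t = expR (L * (t0 - t%:R)).
Proof.
rewrite mulrBr L_t0 expRD lnK ?posrE ?ltr0n//; congr (_ * _).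
by rewrite -mulNr opprK expRM_natr lnK// posrE.
Qed.

(** Moving by [c] windows of length [1 / b] changes the logarithm of the mean by at least [c]. *)
Let L_cb : c <= L * (c / b).
Proof.
by rewrite mulrCA -[leLHS]mulr1 ler_wpM2l// ler_pdivlMr// mul1r le_neg_ln1B.
Qed.

(** Rounding the time down loses less than one step, which costs at most a factor [(1 - b)^-1]. *)
Lemma mean_after_cutoff :
  m%:R * (1 - b) ^+ Num.truncn (t0 + c * (1 / b)) <= expR (- c) / (1 - b).
Proof.
rewrite meanE -[X in _ <= _ / X]lnK ?posrE// -expRN -expRD ler_expR -/L div1r.
have := truncnS_gt (t0 + c / b); set k := Num.truncn _ => kP.
have {}kP : t0 - k%:R <= 1 - c / b by move: kP; rewrite -natr1; lra.
apply: (@le_trans _ _ (L * (1 - c / b))); first by rewrite ler_wpM2l// ltW.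
by move: L_cb; rewrite mulrBr; lra.
Qed.

(** Rounding down only increases the mean. A positive [k] excludes a negative argument, which
    [Num.truncn] would move up to 0. *)
Lemma mean_before_cutoff (k := Num.truncn (t0 - c * (1 / b))) : (0 < k)%N ->
  expR c <= m%:R * (1 - b) ^+ k.
Proof.
rewrite meanE ler_expR; move=> k0.
have x0 : 0 <= t0 - c * (1 / b).
  by move: k0; rewrite truncn_gt0; apply: le_trans.
have /andP[kx _] := truncn_itv x0; rewrite -/k div1r in kx.
by apply: (le_trans L_cb); rewrite ler_wpM2l//; [exact: ltW|lra].
Qed.

End Asymptotics.

(** * Cutoff and the order of the window *)

Theorem proposition2 (R : realType) (n0 : nat)
    (A : forall n, arrangement R n)
    (w : forall n, face (A n) -> R)
    (pi : forall n, chamber (A n) -> R)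
    (G : nat -> groupType) (rho : forall n, G n -> 'M[R]_n)
    (b d : nat -> R) :
  (forall n, (n0 <= n)%N -> (0 < nhyp (A n))%N) ->
  (forall n, (n0 <= n)%N -> prob_dist (w n) /\ separating (w n)) ->
  (forall n, (n0 <= n)%N -> stationary (w n) (pi n)) ->
  (forall n, (n0 <= n)%N ->
    [/\ linear_action (rho n), preserves_arrangement (A n) (rho n),
        chamber_transitive (A n) (rho n) & invariant_weights (rho n) (w n)]) ->
  (exists2 delta : R, 0 < delta &
    forall n, (n0 <= n)%N -> b n <= 1 - delta /\ d n <= 1 - delta) ->
  (forall n, (n0 <= n)%N -> forall i : 'I_(nhyp (A n)),
    b n = \sum_(F : face (A n) | ~~ `[< points F `<=` hyperplane i >]) w n F) ->
  (forall n, (n0 <= n)%N -> forall i j : 'I_(nhyp (A n)), i != j ->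
    \sum_(F : face (A n) |
          ~~ `[< points F `<=` hyperplane i `|` hyperplane j >]) w n F = d n) ->
  (forall n, (n0 <= n)%N -> b n <= (1 + d n) / 2) ->
  (forall n, (n0 <= n)%N -> 0 < d n /\ d n <= b n ^+ 2) ->
  let t n := logb (1 / (1 - b n)) (nhyp (A n))%:R in
  let r n := 1 / b n in
  cutoff (fun n => separation (w n) (pi n)) t r /\
  (nhyp (A n) @[n --> \oo] --> \oo -> (r : nat -> R^o) =o_\oo (t : nat -> R^o)).
Proof.
move=> m_gt0 w_dist pi_stat sym [delta delta_gt0 b_le] b_mass d_mass _ d_bnd t r.
have b_gt0 n : (n0 <= n)%N -> 0 < b n.
  move=> n0n; have [d_gt0 d_le] := d_bnd n n0n.
  have [[w_ge0 _] _] := w_dist n n0n.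
  (* [b n] is a sum of weights, hence nonnegative, and [0 < d n <= b n ^+ 2] keeps it from being
     0. *)
  rewrite lt0r; apply/andP; split.
    by apply: contraTneq (lt_le_trans d_gt0 d_le) => ->; rewrite expr0n ltxx.
  by rewrite (b_mass n n0n (Ordinal (m_gt0 n n0n))); apply: sumr_ge0.
have b_lt1 n : (n0 <= n)%N -> b n < 1.
  by move=> n0n; have [] := b_le n n0n; lra.
have sepE n k : (n0 <= n)%N ->
    separation (w n) (pi n) k = unseparated_prob (w n) k.
  move=> n0n; have [act arr trans inv] := sym n n0n;
    have [wd _] := w_dist n n0n.
  apply: (separationE act arr trans inv) => //; last exact: pi_stat.
  exact: (unseparated_prob_cvg0 wd (b_mass n n0n) (b_gt0 n n0n) (ltW
    (b_lt1 n n0n))).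
have sep01 n k : (n0 <= n)%N -> 0 <= separation (w n) (pi n) k <= 1.
  move=> n0n; have [wd _] := w_dist n n0n.
  by rewrite sepE// unseparated_prob_ge0//= unseparated_prob_le1.
split; first split.
- apply: (@squeeze_cvgr _ _ _ _ (fun c : R => 1 - expR (- c)) (cst 1));
    last first.
  + exact: cvg_cst.
  + rewrite -[X in _ --> X]subr0; apply: cvgB; first exact: cvg_cst.
    exact: cvgr_expR.
  near=> c; have c_ge0 : 0 <= c by near: c; exact: nbhs_pinfty_ge.
  apply: (@limn_inf_bounds _ n0) => n n0n.
  case/andP: (sep01 n (Num.truncn (t n - c * r n)) n0n) => _ ->; rewrite andbT.
  have [wd _] := w_dist n n0n; have [_ d_le] := d_bnd n n0n.
  (* If the time truncates to 0, the separation is 1; otherwise the mean is at least [expR c]. *)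
  rewrite sepE//; set k := Num.truncn _; have := leq0n k;
    rewrite leq_eqVlt => /orP[/eqP <-|k_gt0].
    by rewrite unseparated_prob0 ?m_gt0// gerBl expR_ge0.
  have mean_ge := mean_before_cutoff (b_gt0 n n0n) (b_lt1 n n0n)
    (m_gt0 n n0n) c_ge0 k_gt0.
  have := unseparated_prob_ge wd (b_mass n n0n) (d_mass n n0n) d_le k.
  rewrite /= -/k in mean_ge *.
  set U := unseparated_prob _ _; set mu := _ * _ in mean_ge * => U_ge.
  have U1 : U <= 1 by exact: unseparated_prob_le1.
  have mu_gt0 : 0 < mu := lt_le_trans (expR_gt0 c) mean_ge.
  (* The second moment bound rearranges to [mu * (1 - U) <= U <= 1]. *)
  have : 1 - U <= mu^-1.
    by rewrite -[leRHS]mul1r ler_pdivlMr//; nra.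
  have : mu^-1 <= expR (- c) by rewrite expRN lef_pV2 ?posrE// expR_gt0.
  by lra.
(* The rounding factor [(1 - b n)^-1] is at most [delta^-1], uniformly in [n]. *)
- apply: (@squeeze_cvgr _ _ _ _ (cst 0) (fun c : R => expR (- c) * delta^-1)).
  + near=> c; have c_ge0 : 0 <= c by near: c; exact: nbhs_pinfty_ge.
    apply: (proj2 (@sups_eventually_bounded _ n0 _ _ _ _)) => n n0n.
    case/andP: (sep01 n (Num.truncn (t n + c * r n)) n0n) => -> _ /=.
    have [wd _] := w_dist n n0n; have [bd _] := b_le n n0n.
    rewrite sepE//; apply: (le_trans (unseparated_prob_le wd (b_mass n n0n) _)).
    apply: (le_trans (mean_after_cutoff (b_gt0 n n0n) (b_lt1 n n0n)
      (m_gt0 n n0n) c_ge0)).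
    rewrite ler_wpM2l ?expR_ge0// lef_pV2 ?posrE//;
      last by rewrite subr_gt0 b_lt1.
    lra.
  + exact: cvg_cst.
  + rewrite -[X in _ --> X](mul0r delta^-1); apply: cvgMl; exact: cvgr_expR.
(* With [L = - ln (1 - b n) <= b n / delta], the ratio [r n / t n = L / (b n * ln m)] is at most
   [1 / (delta * ln m)]; hence the threshold [expR ((eps * delta)^-1)] for [m]. *)
- move=> m_oo; apply/eqoP => eps eps_gt0.
  near=> n.
  have n0n : (n0 <= n)%N by near: n; exact: nbhs_infty_ge.
  have [bd _] := b_le n n0n; have bp := b_gt0 n n0n; have bl := b_lt1 n n0n.
  have m_ge : expR ((eps * delta)^-1) <= (nhyp (A n))%:R.
    apply: (le_trans (ltW (truncnS_gt _))); rewrite ler_nat.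
    by near: n; exact: (m_oo _ (nbhs_infty_ge _)).
  have lnm : (eps * delta)^-1 <= ln (nhyp (A n))%:R.
    by rewrite -[leLHS]expRK ler_ln// posrE ?expR_gt0 ?ltr0n ?m_gt0.
  have t_ge0 : 0 <= t n by exact: logb_ge0 bp bl (m_gt0 n n0n).
  have r_ge0 : 0 <= r n by rewrite /r div1r invr_ge0 ltW.
  rewrite !ger0_norm//.
  have L_gt0 : 0 < - ln (1 - b n) := lt_le_trans bp (le_neg_ln1B bl).
  have L_le : - ln (1 - b n) <= b n / delta.
    apply: (le_trans (neg_ln1B_le bp bl)).
    by rewrite ler_wpM2l ?(ltW bp)// lef_pV2 ?posrE ?subr_gt0//; lra.
  rewrite /t /logb ln_inv1B// /r div1r mulrA ler_pdivlMr//.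
  apply: (@le_trans _ _ delta^-1).
    by rewrite mulrC ler_pdivrMr// mulrC.
  by rewrite -[leLHS](mulVKf (lt0r_neq0 eps_gt0)) -invfM ler_wpM2l// ltW.
Unshelve. all: by end_near. Qed.
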